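(* Let $N$ be a random variable on $\mathbb{N}_0$ and let $(X_i)_{i\ge 1}$ be an iid sequence of random variables on $\mathbb{N}_0$, independent of $N$. Let $k\in\mathbb{N}$ and assume $E N^k<\infty$. Let $S_N=\sum_{i=1}^N X_i$ and $m_k(\ell)=E[N^k;S_N=\ell]$ for $\ell\in\mathbb{N}_0$. Then the generating function $G_{m_k}(u)=\sum_{\ell=0}^\infty u^\ell m_k(\ell)$ of $m_k$ has the form $$G_{m_k}(u)=\sum_{j=1}^{k}\left\{\begin{matrix}k\\ j\end{matrix}\right\}\,\big(G_{X_1}(u)\big)^{j}\;G_N^{(j)}\big(G_{X_1}(u)\big),\qquad u\in\mathbb{C},\ |u|\le 1.$$
   Context: $\mathbb{N}=\{1,2,\ldots\}$ and $\mathbb{N}_0=\{0,1,2,\ldots\}$. For a random variable $Y$ and an event $A$, $E[Y;A]:=E[Y\,I_A]$, where $I_A$ is the indicator of $A$. The empty sum is $0$ (so $S_N=0$ when $N=0$), and $0^0=1$. For an $\mathbb{N}_0$-valued random variable $Y$, $G_Y(u):=E[u^Y]$ for $|u|\le 1$. $G_Y^{(j)}(u)$ denotes the $j$-th derivative of $G_Y(x)$ at $x=u$; since $G_Y$ is defined on the closed unit disk, at points $|u|=1$ derivatives are taken within the closed unit disk. $\left\{\begin{matrix}k\\ j\end{matrix}\right\}$ is the Stirling number of the second kind: the number of ways of partitioning a set of $k$ elements into $j$ non-empty subsets. *)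

(* Defs.v *)
From HB Require Import structures.
From mathcomp Require Import all_boot all_order all_algebra.
From mathcomp Require Import all_classical all_reals all_analysis.
From mathcomp Require Export complex.

Set Implicit Arguments.
Unset Strict Implicit.
Unset Printing Implicit Defensive.

Import Order.TTheory GRing.Theory Num.Theory.
Import numFieldNormedType.Exports.

Local Open Scope classical_set_scope.
Local Open Scope ring_scope.

Section Independence.
Context {d d' : measure_display} {T : measurableType d} {T' : measurableType d'}
  {R : realType}.
Variable P : probability T R.

Definition mutually_independent (X : nat -> {RV P >-> T'}) : Prop :=
  forall (s : seq nat) (A : nat -> set T'),
    uniq s -> (forall i, measurable (A i)) ->
    P (\bigcap_(i in [set` s]) (X i @^-1` A i)) =
    (\prod_(i <- s) P (X i @^-1` A i))%E.

Definition identically_distributed (X : nat -> {RV P >-> T'}) : Prop :=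
  forall (i j : nat) (A : set T'), measurable A ->
    distribution P (X i) A = distribution P (X j) A.

Definition iid (X : nat -> {RV P >-> T'}) : Prop :=
  mutually_independent X /\ identically_distributed X.

Definition sigma_of_sequence (X : nat -> {RV P >-> T'}) : set (set T) :=
  <<s \bigcup_i preimage_set_system setT (X i) measurable >>.

Definition independent_of_sequence
    (Y : {RV P >-> T'}) (X : nat -> {RV P >-> T'}) : Prop :=
  forall (A : set T') (B : set T), measurable A -> sigma_of_sequence X B ->
    P ((Y @^-1` A) `&` B) = (P (Y @^-1` A) * P B)%E.

End Independence.

Section Expectations.
Context {d : measure_display} {T : measurableType d} {R : realType}.
Variable P : probability T R.

Definition expectation_on (Y : T -> R) (A : set T) : \bar R :=
  'E_P[(fun w => Y w * \1_A w)].

(* [fine] sends infinite values to 0, so this is only meaningful when the real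
   and imaginary parts of [Z] are integrable, e.g. for bounded [Z]. *)
Definition cexpectation (Z : T -> R[i]) : R[i] :=
  Complex (fine 'E_P[(fun w => complex.Re (Z w))])
          (fine 'E_P[(fun w => complex.Im (Z w))]).

Definition pgf (Y : T -> nat) (u : R[i]) : R[i] :=
  cexpectation (fun w => u ^+ Y w).

End Expectations.

Section DerivativeWithin.
Context {K : numFieldType}.
Variable D : set K.

Definition diff_quotient (f : K -> K) (x y : K) : K := (f y - f x) / (y - x).

Definition derivable_within (f : K -> K) (x : K) : Prop :=
  cvg (diff_quotient f x y @[y --> within D x^']).

Definition derive_within (f : K -> K) (x : K) : K :=
  lim (diff_quotient f x y @[y --> within D x^']).

Definition derive_within_n (j : nat) (f : K -> K) : K -> K :=
  iter j derive_within f.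

(* [lim] is total, so the values of [derive_within_n j f] on [D] are genuine
   derivatives only when this holds. *)
Definition derivable_within_n (j : nat) (f : K -> K) : Prop :=
  forall i x, (i < j)%N -> D x -> derivable_within (derive_within_n i f) x.

End DerivativeWithin.

Section GeneratingFunction.
Context {K : numFieldType}.

Definition gf_series (a : nat -> K) (u : K) : nat -> K :=
  series (fun l => u ^+ l * a l).

Definition gf_cvg (a : nat -> K) (u : K) : Prop := cvgn (gf_series a u).

Definition gf (a : nat -> K) (u : K) : K := limn (gf_series a u).

End GeneratingFunction.

Definition closed_unit_disk (R : realType) : set R[i] := [set z | `|z| <= 1].

Definition stirling2 (k j : nat) : nat :=
  #|[set Q : {set {set 'I_k}} | finset.partition Q [set: 'I_k] & #|Q| == j]%SET|.

Section RandomSums.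
Context {d : measure_display} {T : measurableType d} {R : realType}.
Variable P : probability T R.

(* The sequence is indexed from 0: [X 0], [X 1], ... stand for X_1, X_2, ... *)
Definition random_sum (N : T -> nat) (X : nat -> T -> nat) (w : T) : nat :=
  (\sum_(i < N w) X i w)%N.

(* When E N^k is finite all these expectations are finite, so [fine] loses
   nothing. *)
Definition m_ (N : T -> nat) (X : nat -> T -> nat) (k l : nat) : R :=
  fine (expectation_on P (fun w => (N w)%:R ^+ k)
          [set w | random_sum N X w = l]).

End RandomSums.

(* Main.v *)
Require Import Defs.
From HB Require Import structures.
From mathcomp Require Import all_boot all_order all_algebra.
From mathcomp Require Import all_classical all_reals all_analysis.
From mathcomp Require Import measurable_realfun ring lra.
Import Order.TTheory GRing.Theory Num.Theory.
Import numFieldNormedType.Exports.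

Set Implicit Arguments.
Unset Strict Implicit.
Unset Printing Implicit Defensive.

(** Write [g] for the generating function of a summand at [u], so that
    [`|g| <= 1]. Summing the series in [l] first gives

      gf = E[N^k u^S_N]       ([gf_moments]).

    On the event [N = n] independence makes [u^S_N] average to [g^n]
    ([cexp_sum_given]), hence this equals [E[N^k g^N]]
    ([cexp_weighted_random_sum]). Sorting functions between finite sets by their
    kernels gives the identity [n^k = sum_j S(k,j) n^_j] between powers and
    falling factorials ([expn_stirling2]), and

      n^_j g^n = g^j (n^_j g^(n-j)),

    where [E[N^_j g^(N-j)]] is the [j]-th derivative of the generating function of
    [N] at [g] ([derive_within_n_pgf]).

    The last point is where the moment assumption acts up to the boundary of the
    disk. Difference quotients of [z^n] within the disk are bounded by a multiple
    of [n], so one differentiation costs one moment: starting from the integrable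
    weight [N^_j] it needs [N^_(j+1)] integrable, which holds as long as [j < k]
    ([weighted_power_derive]).

    All exchanges of limits reduce to one statement, [cexp_truncate]: the
    expectation of a dominated complex variable is the limit of its truncations.
    After truncation to finitely many values only finite sums occur. *)

(** * Powers and falling factorials *)

Section Stirling.
Import mathcomp.boot.finset.
Section Kernel.
Variables I J : finType.

(** The blocks of [Q] are recovered from the equivalence relation they induce, so
    comparing kernels of functions with [Q] amounts to comparing relations. *)
Lemma preim_partition_eqP (Q : {set {set I}}) (f : I -> J) :
  partition Q [set: I] ->
  reflect (forall x y, (f x == f y) = (pblock Q x == pblock Q y))
          (preim_partition f [set: I] == Q).
Proof.
move=> QP; have /and3P[/eqP covQ trivQ _] := QP.
apply: (iffP eqP) => [defQ x y | fQ].
  rewrite eq_pblock ?covQ ?inE // -{1}defQ /preim_partition.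
  rewrite pblock_equivalence_partition ?inE // => a b c _ _ _ /=.
  by split=> // /eqP ->.
rewrite -[RHS](preim_partition_pblock QP) /preim_partition.
rewrite /equivalence_partition; apply: eq_imset => x.
by apply/setP => y; rewrite !inE fQ.
Qed.

(** A function whose kernel is [Q] factors through the blocks of [Q] by a unique
    injection, and the falling factorial counts those injections. *)
Lemma card_preim_partition (Q : {set {set I}}) :
  partition Q [set: I] ->
  #|[set f : {ffun I -> J} | preim_partition f [set: I] == Q]| = #|J| ^_ #|Q|.
Proof.
move=> QP; have /and3P[/eqP covQ trivQ Q0] := QP.
have blockQ x : pblock Q x \in Q by rewrite pblock_mem ?covQ ?inE.
pose B : finType := {b : {set I} | b \in Q}.
pose phi (h : {ffun B -> J}) := [ffun x => h (exist _ (pblock Q x) (blockQ x))].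
have blockP (b : B) : exists x, b == exist _ (pblock Q x) (blockQ x).
  case: b => b bQ; have /set0Pn[x xb] : b != set0.
    by apply: contraNneq Q0 => <-.
  by exists x; rewrite -val_eqE /= (def_pblock trivQ bQ xb).
have phi_inj : injective phi.
  move=> h h' /ffunP eqh; apply/ffunP => b; have [x /eqP ->] := blockP b.
  by have := eqh x; rewrite !ffunE.
transitivity #|[set h : {ffun B -> J} | injectiveb h]|; last first.
  by rewrite card_inj_ffuns card_sig; congr (_ ^_ _); apply: eq_card.
rewrite -(card_imset _ phi_inj); apply: eq_card => f; rewrite inE.
apply/(preim_partition_eqP _ QP)/imsetP => [fQ | [h]].
  (* The injection is read off at a representative of each block. *)
  pose x0 (b : B) := xchoose (blockP b).
  have x0P b : val b = pblock Q (x0 b).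
    by rewrite [in LHS](eqP (xchooseP (blockP b))).
  exists [ffun b => f (x0 b)].
    rewrite inE; apply/injectiveP => b b'; rewrite !ffunE => /eqP.
    by rewrite fQ -!x0P => /eqP /val_inj.
  by apply/ffunP => x; rewrite !ffunE; apply/eqP; rewrite fQ -x0P.
rewrite inE => /injectiveP h_inj -> x y; rewrite !ffunE.
by rewrite (inj_eq h_inj).
Qed.

Lemma leq_card_partition (Q : {set {set I}}) :
  partition Q [set: I] -> #|Q| <= #|I|.
Proof. by move=> QP; rewrite -(card_transversal (transversalP QP)) max_card. Qed.

End Kernel.

(** Both sides count the functions from ['I_k] to ['I_n]; on the right they are
    sorted by kernel, and then by the number of blocks of the kernel. *)
Lemma expn_stirling2 (n k : nat) :
  n ^ k = \sum_(j < k.+1) stirling2 k j * n ^_ j.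
Proof.
rewrite -[n in LHS]card_ord -[k in LHS]card_ord -card_ffun -sum1_card.
pose ker (f : {ffun 'I_k -> 'I_n}) := preim_partition f [set: 'I_k].
rewrite (partition_big ker (fun Q => partition Q setT)) /=; last first.
  by move=> f _; apply: preim_partitionP.
pose blocks (Q : {set {set 'I_k}}) : 'I_k.+1 := inord #|Q|.
rewrite (partition_big blocks xpredT) //=; apply: eq_bigr => j _.
rewrite /stirling2 -sum_nat_const; apply: eq_big => [Q | Q /andP[QP /eqP <-]].
  rewrite inE; case: (boolP (partition Q _)) => //= QP.
  by rewrite -val_eqE /= inordK // ltnS -[X in _ <= X]card_ord leq_card_partition.
rewrite sum1dep_card card_preim_partition // card_ord inordK //.
by rewrite ltnS -[X in _ <= X]card_ord leq_card_partition.
Qed.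
End Stirling.

(** * Derivatives and limits on the closed unit disk *)

Local Open Scope classical_set_scope.
Local Open Scope ring_scope.

Section UnitDisk.
Variable K : numFieldType.
Implicit Types (x y : K).

Lemma norm_exp_le1 x n : `|x| <= 1 -> `|x ^+ n| <= 1.
Proof. by move=> x1; rewrite normrX exprn_ile1. Qed.

Lemma norm_expB_le x y n : `|x| <= 1 -> `|y| <= 1 ->
  `|x ^+ n - y ^+ n| <= n%:R * `|x - y|.
Proof.
move=> x1 y1; rewrite subrXX normrM mulrC ler_wpM2r //.
apply: le_trans (ler_norm_sum _ _ _) _.
apply: (@le_trans _ _ (\sum_(i < n) 1)); last by rewrite sumr_const card_ord.
by apply: ler_sum => i _; rewrite normrM mulr_ile1 ?norm_exp_le1.
Qed.

Lemma diff_quotient_expE x y n : y != x ->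
  diff_quotient (fun z => z ^+ n) x y - n%:R * x ^+ n.-1 =
  \sum_(i < n) (y ^+ (n.-1 - i) - x ^+ (n.-1 - i)) * x ^+ i.
Proof.
rewrite -subr_eq0 => yx; rewrite /diff_quotient subrXX mulrC mulKf //.
rewrite mulr_natl -[in X in _ *+ X](card_ord n) -sumr_const -sumrB.
apply: eq_bigr => i _; rewrite mulrBl -exprD subnK //.
by rewrite -ltnS prednK // (leq_ltn_trans _ (ltn_ord i)).
Qed.

(** Two bounds are needed: the second one makes the error vanish as [y] tends to
    [x] for each fixed [n], the first one grows only linearly in [n] and so can be
    integrated against a law with finite mean. *)
Lemma diff_quotient_exp_le x y n : `|x| <= 1 -> `|y| <= 1 -> y != x ->
  `|diff_quotient (fun z => z ^+ n) x y - n%:R * x ^+ n.-1| <= n%:R * 2 /\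
  `|diff_quotient (fun z => z ^+ n) x y - n%:R * x ^+ n.-1|
     <= n%:R * (n%:R * `|y - x|).
Proof.
move=> x1 y1 yx; rewrite diff_quotient_expE //.
have bnd c : (forall m, (m <= n)%N -> `|y ^+ m - x ^+ m| <= c) ->
    `|\sum_(i < n) (y ^+ (n.-1 - i) - x ^+ (n.-1 - i)) * x ^+ i| <= n%:R * c.
  move=> hc; apply: le_trans (ler_norm_sum _ _ _) _.
  rewrite mulr_natl -[in X in _ *+ X](card_ord n) -sumr_const.
  apply: ler_sum => i _; rewrite normrM -[leRHS]mulr1.
  apply: ler_pM => //; last exact: norm_exp_le1.
  by apply: hc; rewrite (leq_trans (leq_subr _ _)) ?leq_pred.
split; apply: bnd => m mn.
  by apply: le_trans (ler_normB _ _) _; rewrite -[2]/(1 + 1) lerD ?norm_exp_le1.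
apply: le_trans (norm_expB_le _ y1 x1) _.
by rewrite ler_wpM2r // ler_nat.
Qed.

Let D : set K := [set z | `|z| <= 1].

(** The disk has no isolated points, by convexity: moving from [x] slightly
    towards another point [c] of the disk stays in the disk. *)
Lemma within_disk_proper x : D x -> ProperFilter (within D x^').
Proof.
move=> /= Dx; apply: Build_ProperFilter_ex => A.
rewrite /within /dnbhs /= => /nbhs_ballP[e /= e0 xA].
have [c Dc cx] : exists2 c : K, D c & c != x.
  have [->|x0] := eqVneq x 0.
    by exists 1; rewrite /D /= ?normr1 // oner_neq0.
  by exists 0; rewrite /D /= ?normr0 // eq_sym.
(* [`|c - x| <= 2], so this step has length at most [t * 2 < e]. *)
pose t : K := e / (e + 2).
have e2 : 0 < e + 2 by rewrite addr_gt0.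
have t0 : 0 < t by rewrite divr_gt0.
have t1 : t <= 1 by rewrite ler_pdivrMr // mul1r lerDl.
have te : t * 2 < e.
  by rewrite /t mulrAC ltr_pdivrMr // ltr_pM2l // ltrDr.
clearbody t; exists (x + t * (c - x)); apply: xA.
- rewrite /ball /= opprD addNKr normrN normrM gtr0_norm //.
  apply: le_lt_trans te; rewrite ler_wpM2l ?(ltW t0) //.
  by apply: le_trans (ler_normB _ _) _; rewrite -[2]/(1 + 1) lerD.
- rewrite /= -subr_eq0 addrAC subrr add0r.
  by rewrite mulf_neq0 ?subr_eq0 ?(gt_eqF t0).
- rewrite /D /= (_ : x + _ = (1 - t) * x + t * c); last first.
    by rewrite mulrBr mulrBl mul1r addrCA addrC addrAC.
  apply: le_trans (ler_normD _ _) _; rewrite !normrM (gtr0_norm t0).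
  rewrite ger0_norm ?subr_ge0 // -[leRHS](subrK t) lerD //.
    by rewrite ler_piMr ?subr_ge0.
  by rewrite ler_piMr // ltW.
Qed.

(** An epsilon-delta criterion, stated over an abstract field: it turns
    the topological limit into norm estimates, which is what the expectation bounds
    deliver. *)
Lemma derive_within_diskP (f : K -> K) x l : D x ->
  (forall e, 0 < e -> exists2 r : K, 0 < r &
     forall y, D y -> y != x -> `|y - x| < r ->
       `|diff_quotient f x y - l| <= e) ->
  derivable_within D f x /\ derive_within D f x = l.
Proof.
move=> Dx fl; have FF := within_disk_proper Dx.
have cv : diff_quotient f x y @[y --> within D x^'] --> l.
  apply/cvgrPdist_le => e e0; have [r r0 hr] := fl e e0.
  rewrite /prop_near1 /within /dnbhs /nbhs /=.
  apply/nbhs_ballP; exists r => //= y xy yx Dy.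
  by rewrite distrC hr // distrC.
split; first by apply/cvg_ex; exists l.
by apply: cvg_lim => //; apply: norm_hausdorff.
Qed.

(** Since a derivative within the disk is blind to values taken outside, a formula
    known on the disk alone can be differentiated again. *)
Lemma eq_derive_within_disk (f g : K -> K) x l : D x ->
  (forall y, D y -> f y = g y) ->
  derivable_within D g x /\ derive_within D g x = l ->
  derivable_within D f x /\ derive_within D f x = l.
Proof.
move=> Dx fg; rewrite /derivable_within /derive_within.
suff -> : (diff_quotient f x y @[y --> within D x^']) =
  (diff_quotient g x y @[y --> within D x^']) by [].
apply/seteqP; split => A; rewrite /fmap /=.
  all: rewrite /within /nbhs /=; apply: filterS => y Ay Dy;
    by have := Ay Dy; rewrite /= /diff_quotient !fg.
Qed.

(** Naming convergence over an abstract [numFieldType] allows it to be used at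
    [R[i]], whose topology is only reached through that structure. *)
Definition tends_to (s : nat -> K) (l : K) : Prop := s n @[n --> \oo] --> l.

Lemma tends_toP (s : nat -> K) l :
  (forall e : K, 0 < e -> exists M, forall n, (M <= n)%N -> `|l - s n| <= e) ->
  tends_to s l.
Proof.
move=> h; apply/cvgrPdist_le => e /h[M hM].
by exists M => // n /= /hM.
Qed.

Lemma tends_to_unique s l l' : tends_to s l -> tends_to s l' -> l = l'.
Proof. exact: (cvg_unique (@norm_hausdorff _ _)). Qed.

Lemma tends_toX s l n : tends_to s l -> tends_to (fun i => s i ^+ n) (l ^+ n).
Proof.
move=> sl; elim: n => [|n ih].
  by rewrite /tends_to; under eq_fun do rewrite expr0; exact: cvg_cst.
by rewrite /tends_to exprS; under eq_fun do rewrite exprS; exact: cvgM.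
Qed.

Lemma tends_toZ s l c : tends_to s l -> tends_to (fun i => c * s i) (c * l).
Proof. by move=> sl; apply: cvgM => //; exact: cvg_cst. Qed.

Lemma tends_to_gf a u l : tends_to (gf_series a u) l ->
  gf_cvg a u /\ gf a u = l.
Proof.
move=> h; split; first by apply/cvg_ex; exists l.
by apply: cvg_lim => //; apply: norm_hausdorff.
Qed.
End UnitDisk.

(** * Variables with measurable preimages *)

Section Preimages.
Context {d : measure_display} {T : measurableType d}.

(** All the random quantities here are functions of countably many values, hence
    have every preimage measurable. This condition, unlike measurability with
    respect to a fixed sigma-algebra on the target, is stable under composition
    with arbitrary functions. *)
Definition all_preimages_measurable (V : Type) (Z : T -> V) :=
  forall A : set V, measurable (Z @^-1` A).

Lemma apm_comp V W (f : V -> W) (Z : T -> V) :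
  all_preimages_measurable Z -> all_preimages_measurable (fun w => f (Z w)).
Proof. by move=> mZ A; exact: (mZ (f @^-1` A)). Qed.

Lemma apm_cst V (c : V) : all_preimages_measurable (fun _ : T => c).
Proof.
move=> A; have [Ac|nAc] := pselect (A c).
  by rewrite (_ : _ @^-1` _ = setT) //; apply/seteqP; split.
by rewrite (_ : _ @^-1` _ = set0) //; apply/seteqP; split.
Qed.

(** A function selected by a countable random index is measurable piecewise;
    random sums have this form. *)
Lemma apm_random_index V (Y : T -> nat) (H : nat -> T -> V) :
  all_preimages_measurable Y -> (forall n, all_preimages_measurable (H n)) ->
  all_preimages_measurable (fun w => H (Y w) w).
Proof.
move=> mY mH A.
rewrite (_ : _ @^-1` A =
    \bigcup_n ((Y @^-1` [set n]) `&` (H n @^-1` A))).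
  by apply: bigcup_measurable => n _; apply: measurableI; [exact: mY|exact: mH].
apply/seteqP; split => [w /= Aw|w [n _ [/= <- //]]].
by exists (Y w).
Qed.

Lemma apm_nat (Y : T -> nat) : measurable_fun setT Y ->
  all_preimages_measurable Y.
Proof. by move=> mY A; rewrite -[_ @^-1` _]setTI; apply: mY. Qed.

Lemma apm_op2 V W (f : nat -> V -> W) (Y : T -> nat) (Z : T -> V) :
  all_preimages_measurable Y -> all_preimages_measurable Z ->
  all_preimages_measurable (fun w => f (Y w) (Z w)).
Proof.
move=> mY mZ; apply: (@apm_random_index _ _ (fun n w => f n (Z w))) => // n.
exact: apm_comp.
Qed.

Lemma apm_sum (X : nat -> T -> nat) n :
  (forall i, all_preimages_measurable (X i)) ->
  all_preimages_measurable (fun w => \sum_(i < n) X i w)%N.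
Proof.
move=> mX; elim: n => [|n ih].
  by under eq_fun do rewrite big_ord0; exact: apm_cst.
by under eq_fun do rewrite big_ord_recr /=; exact: apm_op2.
Qed.

Lemma apm_all (b : nat -> T -> bool) n :
  (forall i, all_preimages_measurable (b i)) ->
  all_preimages_measurable (fun w => [forall i : 'I_n, b i w]).
Proof.
move=> mb.
rewrite (_ : (fun w => _) = fun w => \big[andb/true]_(i < n) b i w); last first.
  apply/funext => w; rewrite big_andE.
  by apply/forallP/forallP => h i; exact: h.
elim: n => [|n ih].
  by under eq_fun do rewrite big_ord0; exact: apm_cst.
under eq_fun do rewrite big_ord_recr /=.
have mbn := apm_comp nat_of_bool (mb n).
rewrite (_ : (fun w => _) =
  fun w => (fun m c => c && odd m) (nat_of_bool (b n w))
    (\big[andb/true]_(i < n) b i w)).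
  exact: (apm_op2 (fun m c => c && odd m) mbn ih).
by apply/funext => w /=; case: (b n w).
Qed.

Lemma apm_measurable (R : realType) (Z : T -> R) :
  all_preimages_measurable Z -> measurable_fun setT Z.
Proof. by move=> mZ _ A _; rewrite setTI; exact: mZ. Qed.
End Preimages.

(** * Expectation of complex variables *)

Section ComplexExpectation.
Context {d : measure_display} {T : measurableType d} {R : realType}.
Variable P : probability T R.
Local Notation integ f := (P.-integrable setT (EFin \o f)).
Implicit Types (f A : T -> R) (Z : T -> R[i]).

Definition mean f : R := fine 'E_P[f].

Lemma meanE f : mean f = (\int[P]_x f x)%R.
Proof. by rewrite /mean unlock. Qed.

Definition cintegrable Z :=
  integ (fun w => complex.Re (Z w)) /\ integ (fun w => complex.Im (Z w)).

Lemma cexpE Z : cexpectation P Z =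
  Complex (mean (fun w => complex.Re (Z w))) (mean (fun w => complex.Im (Z w))).
Proof. by []. Qed.

Lemma ImE (z : R[i]) : complex.Im z = complex.Re (z * -'i%C).
Proof. by rewrite mulrN raddfN /= ReiNIm opprK. Qed.

Lemma norm_Im_le (z : R[i]) : `|complex.Im z|%:C%C <= `|z|.
Proof.
rewrite ImE; apply: le_trans (normc_ge_Re _) _.
by rewrite normrM normrN [X in _ * X]normc_def /= expr0n add0r expr1n sqrtr1 mulr1.
Qed.

Lemma norm_le_ge0 (z : R[i]) (a : R) : `|z| <= a%:C%C -> 0 <= a.
Proof. by move=> za; rewrite -lecR (le_trans (normr_ge0 z) za). Qed.

Lemma integrable_real_le f A : all_preimages_measurable f -> integ A ->
  (forall w, `|f w| <= A w) -> integ f.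
Proof.
move=> mf iA fA; apply: le_integrable iA => //.
  by apply/measurable_EFinP; exact: apm_measurable.
by move=> w _; rewrite /= lee_fin (le_trans (fA w)) // ler_norm.
Qed.

Lemma cintegrable_le Z A : all_preimages_measurable Z -> integ A ->
  (forall w, `|Z w| <= (A w)%:C%C) -> cintegrable Z.
Proof.
move=> mZ iA ZA; split.
  apply: integrable_real_le iA _; first exact: apm_comp.
  by move=> w; rewrite -lecR (le_trans (normc_ge_Re _)).
apply: integrable_real_le iA _; first exact: apm_comp.
by move=> w; rewrite -lecR (le_trans (norm_Im_le _)).
Qed.

Lemma integrable_realD f A : integ f -> integ A -> integ (fun w => f w + A w).
Proof.
move=> hf hA; rewrite (_ : _ \o _ = (EFin \o f) \+ (EFin \o A))%E //.
exact: integrableD.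
Qed.

Lemma integrable_realZ c f : integ f -> integ (fun w => c * f w).
Proof.
by move=> hf; have := integrableZl measurableT c hf.
Qed.

Lemma meanD f g : integ f -> integ g ->
  mean (fun w => f w + g w) = mean f + mean g.
Proof. by move=> hf hg; rewrite !meanE RintegralD. Qed.

Lemma meanZ c f : integ f -> mean (fun w => c * f w) = c * mean f.
Proof. by move=> hf; rewrite !meanE RintegralZl. Qed.

Lemma mean_le f g : integ f -> integ g -> (forall w, f w <= g w) ->
  mean f <= mean g.
Proof. by move=> hf hg fg; rewrite !meanE; apply: le_Rintegral. Qed.

Lemma cintegrableD Z Z' : cintegrable Z -> cintegrable Z' ->
  cintegrable (fun w => Z w + Z' w).
Proof.
move=> [r i] [r' i']; split.
  rewrite (_ : (fun w => _) = fun w => complex.Re (Z w) + complex.Re (Z' w)).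
    exact: integrable_realD.
  by apply/funext => w; rewrite raddfD.
rewrite (_ : (fun w => _) = fun w => complex.Im (Z w) + complex.Im (Z' w)).
  exact: integrable_realD.
by apply/funext => w; rewrite raddfD.
Qed.

Lemma cexpD Z Z' : cintegrable Z -> cintegrable Z' ->
  cexpectation P (fun w => Z w + Z' w) = cexpectation P Z + cexpectation P Z'.
Proof.
move=> [r i] [r' i']; rewrite !cexpE.
rewrite (funext (fun w => raddfD _ (Z w) (Z' w) : complex.Re _ = _)).
rewrite (funext (fun w => raddfD _ (Z w) (Z' w) : complex.Im _ = _)).
by rewrite !meanD.
Qed.

Lemma Re_mul (c z : R[i]) : complex.Re (c * z) =
  complex.Re c * complex.Re z + (- complex.Im c) * complex.Im z.
Proof. by case: c z => [a b] [x y]; rewrite /= mulNr. Qed.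

Lemma Im_mul (c z : R[i]) : complex.Im (c * z) =
  complex.Re c * complex.Im z + complex.Im c * complex.Re z.
Proof. by case: c z => [a b] [x y]. Qed.

Lemma cintegrableZ c Z : cintegrable Z -> cintegrable (fun w => c * Z w).
Proof.
move=> [r i]; split.
  rewrite (funext (fun w => Re_mul c (Z w))).
  by apply: integrable_realD; exact: integrable_realZ.
rewrite (funext (fun w => Im_mul c (Z w))).
by apply: integrable_realD; exact: integrable_realZ.
Qed.

Lemma cexpZ c Z : cintegrable Z ->
  cexpectation P (fun w => c * Z w) = c * cexpectation P Z.
Proof.
move=> [r i]; rewrite !cexpE.
rewrite (funext (fun w => Re_mul c (Z w))) (funext (fun w => Im_mul c (Z w))).
rewrite !meanD ?meanZ //; try exact: integrable_realZ.
by apply/eqP; rewrite eq_complex Re_mul Im_mul !eqxx.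
Qed.

Lemma cexp0 : cexpectation P (fun=> 0) = 0.
Proof. by rewrite cexpE /mean !expectation_cst. Qed.

Lemma cintegrable0 : cintegrable (fun=> 0).
Proof. by split; exact: integrable0. Qed.

Lemma cintegrable_sum I (r : seq I) (p : pred I) (Z : I -> T -> R[i]) :
  (forall i, cintegrable (Z i)) ->
  cintegrable (fun w => \sum_(i <- r | p i) Z i w).
Proof.
move=> iZ; elim: r => [|i r ih].
  by under eq_fun do rewrite big_nil; exact: cintegrable0.
by under eq_fun do rewrite big_cons; case: (p i) => //; exact: cintegrableD.
Qed.

Lemma cexp_sum I (r : seq I) (p : pred I) (Z : I -> T -> R[i]) :
  (forall i, cintegrable (Z i)) ->
  cexpectation P (fun w => \sum_(i <- r | p i) Z i w) =
  \sum_(i <- r | p i) cexpectation P (Z i).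
Proof.
move=> iZ; elim: r => [|i r ih].
  by rewrite big_nil; under eq_fun do rewrite big_nil; exact: cexp0.
rewrite big_cons; under eq_fun do rewrite big_cons; case: (p i) => //.
by rewrite cexpD ?ih //; exact: cintegrable_sum.
Qed.

Lemma cexp_real f : cexpectation P (fun w => (f w)%:C%C) = (mean f)%:C%C.
Proof. by rewrite cexpE /= {2}/mean expectation_cst. Qed.

Lemma cintegrable_real f : integ f -> cintegrable (fun w => (f w)%:C%C).
Proof. by move=> hf; split => //=; exact: integrable0. Qed.

(** Rotating [Z] by a unit complex number makes its expectation real and
    nonnegative; the bound is then monotonicity of the real expectation. The
    sharp constant matters: it keeps the values of generating functions in the
    closed unit disk. *)
Lemma norm_cexp_le Z A : cintegrable Z -> integ A ->
  (forall w, `|Z w| <= (A w)%:C%C) ->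
  `|cexpectation P Z| <= (mean A)%:C%C.
Proof.
move=> iZ iA ZA; set z := cexpectation P Z.
have [z0|z0] := eqVneq z 0.
  rewrite z0 normr0 lecR meanE; apply: Rintegral_ge0 => w _.
  exact: norm_le_ge0 (ZA w).
pose c : R[i] := `|z| / z.
have c1 : `|c| = 1 by rewrite normrM normfV normr_id divff // normr_eq0.
have cz : `|z| = cexpectation P (fun w => c * Z w) by rewrite cexpZ // /c mulfVK.
have [iRe iIm] := cintegrableZ c iZ.
rewrite -(RRe_real (normr_real z)) lecR cz; apply: mean_le => // w.
rewrite -lecR (le_trans _ (ZA w)) // -[leRHS]mul1r -c1 -normrM.
by rewrite (le_trans _ (normc_ge_Re _)) // lecR ler_norm.
Qed.

(** Dominated convergence: the truncated variables vanish pointwise eventually. *)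
Lemma mean_tail A (b : nat -> T -> bool) :
  integ A -> (forall w, 0 <= A w) ->
  (forall n, all_preimages_measurable (b n)) ->
  (forall w, exists M, forall n, (M <= n)%N -> b n w) ->
  forall e : R, 0 < e -> exists M, forall n, (M <= n)%N ->
    mean (fun w => A w * (~~ b n w)%:R) <= e.
Proof.
move=> iA A0 mb bev e e0.
have mA : measurable_fun setT A by apply/measurable_EFinP; case/integrableP: iA.
have h : (\int[P]_x (A x * (~~ b n x)%:R)%:E)%E @[n --> \oo]
    --> (\int[P]_x (cst 0 x))%E.
  apply: (@dominated_cvg _ _ _ P setT measurableT _ _ (EFin \o A)) => //.
  - move=> n; apply/measurable_EFinP; apply: measurable_funM => //.
    apply: apm_measurable; apply: (apm_comp (fun c : bool => (~~ c)%:R)).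
    exact: mb.
  - move=> w _; have [M hM] := bev w.
    apply: cvg_near_cst; exists M => // n /= /hM ->.
    by rewrite mulr0.
  - move=> n w _; rewrite /= lee_fin normrM (ger0_norm (A0 w)).
    by rewrite ler_piMr //; case: (b n w); rewrite ?normr0 ?normr1.
rewrite integral0 in h.
have /fine_cvgP[_ /cvgrPdist_le /(_ e e0)[M _ hM]] := h.
exists M => n Mn; have := hM n Mn; rewrite /= sub0r normrN => hn.
by rewrite meanE (le_trans (ler_norm _)).
Qed.

(** Every exchange of an infinite sum with an expectation goes through this
    lemma: after truncation the sums are finite, and linearity suffices. *)
Lemma cexp_truncate Z A (b : nat -> T -> bool) :
  all_preimages_measurable Z -> integ A ->
  (forall w, `|Z w| <= (A w)%:C%C) ->
  (forall n, all_preimages_measurable (b n)) ->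
  (forall w, exists M, forall n, (M <= n)%N -> b n w) ->
  tends_to (fun n => cexpectation P (fun w => Z w * (b n w)%:R))
    (cexpectation P Z).
Proof.
move=> mZ iA ZA mb bev; apply: tends_toP => e e0.
have er : e = (complex.Re e)%:C%C by rewrite RRe_real // gtr0_real.
have A0 w := norm_le_ge0 (ZA w).
have re0 : 0 < complex.Re e by rewrite -ltcR -er.
have [M hM] := mean_tail iA A0 mb bev re0.
exists M => n /hM hn; rewrite er.
have mZb (c : bool -> bool) : all_preimages_measurable
    (fun w => Z w * (c (b n w))%:R).
  have mbn : all_preimages_measurable (fun w => nat_of_bool (c (b n w))).
    exact: (apm_comp (fun x => nat_of_bool (c x))).
  exact: (apm_op2 (fun x z => z * x%:R) mbn mZ).
have Zb (c : bool -> bool) w :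
    `|Z w * (c (b n w))%:R| <= (A w * (c (b n w))%:R)%:C%C.
  by case: (c _); rewrite ?mulr1 ?mulr0 ?normr0.
have iAb (c : bool -> bool) : integ (fun w => A w * (c (b n w))%:R).
  have mA : measurable_fun setT A.
    by apply/measurable_EFinP; case/integrableP: iA.
  apply: le_integrable iA => //.
    apply/measurable_EFinP; apply: measurable_funM => //.
    exact/apm_measurable/(apm_comp (fun x => (c x)%:R)).
  move=> w _; rewrite /= lee_fin normrM ler_piMr //.
  by case: (c _); rewrite ?normr0 ?normr1.
have iZb c := cintegrable_le (mZb c) (iAb c) (Zb c).
have -> : cexpectation P Z = cexpectation P (fun w => Z w * (b n w)%:R) +
    cexpectation P (fun w => Z w * (~~ b n w)%:R).
  rewrite -(cexpD (iZb id) (iZb negb)); congr cexpectation.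
  by apply/funext => w; case: (b n w); rewrite mulr0 mulr1 ?addr0 ?add0r.
rewrite addrAC subrr add0r.
apply: le_trans (norm_cexp_le (iZb negb) (iAb negb) (Zb negb)) _.
by rewrite lecR.
Qed.

End ComplexExpectation.

(** * Derivatives of probability generating functions *)

Section Deriv.
Context {d : measure_display} {T : measurableType d} {R : realType}.
Variable P : probability T R.
Local Notation integ f := (P.-integrable setT (EFin \o f)).
Local Notation cE := (cexpectation P).

Lemma natr_realc (n : nat) : (n%:R : R)%:C%C = n%:R :> R[i].
Proof. by rewrite raddfMn. Qed.

Lemma gt0_realc (e : R[i]) : 0 < e -> exists2 r : R, 0 < r & e = r%:C%C.
Proof.
move=> e0; have er : e = (complex.Re e)%:C%C by rewrite RRe_real // gtr0_real.
by exists (complex.Re e); rewrite // -ltcR -er.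
Qed.

Section One.
Variables (A W : T -> nat).
Hypotheses (mA : all_preimages_measurable A) (mW : all_preimages_measurable W).
Hypothesis iA : integ (fun w => (A w)%:R : R).
Hypothesis iAW : integ (fun w => (A w * W w)%:R : R).

Let F (u : R[i]) := cE (fun w => (A w)%:R * u ^+ W w).
Let F' (u : R[i]) := cE (fun w => (A w * W w)%:R * u ^+ (W w).-1).

Let mAf (V : Type) (f : nat -> nat -> V) :
  all_preimages_measurable (fun w => f (A w) (W w)).
Proof. exact: apm_op2. Qed.

Let integAW (f g : nat -> nat -> R) : integ (fun w => f (A w) (W w)) ->
  (forall a n, `|g a n| <= f a n) -> integ (fun w => g (A w) (W w)).
Proof.
move=> hf fg; apply: integrable_real_le hf _; first exact: mAf.
by move=> w; exact: fg.
Qed.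

(** Differentiation under the expectation. The error of the difference quotient
    of [z ^+ W w] at distance [h] is at most [W w * (M * h)] where [W w < M], and
    at most [2 * W w] elsewhere. Weighted by [A], the second part has small
    expectation for large [M] because [A * W] is integrable; [h] is then taken
    small for that [M]. All bounds hold on the closed disk, boundary
    included. *)
Lemma weighted_power_derive (x : R[i]) : `|x| <= 1 ->
  derivable_within (@closed_unit_disk R) F x /\
  derive_within (@closed_unit_disk R) F x = F' x.
Proof.
move=> x1; apply: derive_within_diskP => // _ /gt0_realc[r e0 ->].
pose b M w := (W w < M)%N.
have mb M : all_preimages_measurable (b M)
  by exact: (apm_comp (fun n => (n < M)%N)).
have A0 w : 0 <= (A w * W w)%:R :> R by [].
have bev w : exists M, forall n, (M <= n)%N -> b n w by exists (W w).+1.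
(* The tail enters with the factor 2 and may use half of [r], hence [r / 4]. *)
have [M hM] := mean_tail iAW A0 mb bev (divr_gt0 e0 (ltr0n _ 4 : 0 < 4)).
have {}hM := hM M (leqnn M).
pose C : R := mean P (fun w => (A w * W w)%:R).
have C0 : 0 <= C by rewrite /C meanE; apply: Rintegral_ge0.
(* Adding 1 keeps the denominator positive when [C = 0] or [M = 0]. *)
pose c := M%:R * C + 1.
have c0 : 0 < c by rewrite ltr_wpDl // mulr_ge0.
exists ((r / 2 / c)%:C%C).
  by rewrite ltcR !divr_gt0.
move=> y y1 yx yxr.
pose h := complex.Re `|y - x|.
have hE : `|y - x| = h%:C%C by rewrite RRe_real // normr_real.
have h0 : 0 <= h by apply: (norm_le_ge0 (z := y - x)); rewrite hE.
pose dq n := diff_quotient (fun z => z ^+ n) x y - n%:R * x ^+ n.-1.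
pose B w := (M%:R * h) * (A w * W w)%:R + 2 * ((A w * W w)%:R * (~~ b M w)%:R).
have itail : integ (fun w => (A w * W w)%:R * (~~ b M w)%:R : R).
  apply: (integAW (f := fun a n => (a * n)%:R)
    (g := fun a n => (a * n)%:R * (~~ (n < M)%N)%:R)) => // a n.
  by case: (_ < _)%N; rewrite ?mulr0 ?mulr1 ?normr0 ?normr_nat.
have iB : integ B by apply: integrable_realD; exact: integrable_realZ.
have dE w : `|(A w)%:R * dq (W w)| <= (B w)%:C%C.
  have [le2 leh] := diff_quotient_exp_le (W w) x1 y1 yx.
  rewrite -/(dq _) hE in le2 leh; rewrite normrM normr_nat /B.
  rewrite rmorphD !rmorphM /= !natr_realc ?natrM; case: (boolP (b M w)) => Mw.
    rewrite !mulr0 addr0 [leRHS]mulrCA ler_wpM2l //.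
    apply: le_trans leh _; rewrite [leRHS]mulrC ler_wpM2l //.
    apply: ler_wpM2r; [by rewrite -hE | by rewrite ler_nat (ltnW Mw)].
  apply: le_trans (_ : (A w)%:R * ((W w)%:R * 2) <= _).
    by rewrite ler_wpM2l.
  rewrite mulr1 [X in _ <= _ + X]mulrC mulrA lerDr.
  by rewrite !mulr_ge0 // -hE.
have iF z : `|z| <= 1 -> cintegrable P (fun w => (A w)%:R * z ^+ W w).
  move=> z1; apply: cintegrable_le iA _.
    exact: (mAf (fun a n => a%:R * z ^+ n)).
  by move=> w; rewrite natr_realc normrM normr_nat ler_piMr // norm_exp_le1.
have iF' : cintegrable P (fun w => (A w * W w)%:R * x ^+ (W w).-1).
  apply: cintegrable_le iAW _.
    exact: (mAf (fun a n => (a * n)%:R * x ^+ n.-1)).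
  by move=> w; rewrite natr_realc normrM normr_nat ler_piMr // norm_exp_le1.
have -> : diff_quotient F x y - F' x = cE (fun w => (A w)%:R * dq (W w)).
  pose q := (y - x)^-1.
  pose U z w : R[i] := (A w)%:R * z ^+ W w.
  pose V w : R[i] := (A w * W w)%:R * x ^+ (W w).-1.
  have iUx : cintegrable P (fun w => -1 * U x w) := cintegrableZ (-1) (iF x x1).
  have iUD := cintegrableD (iF y y1) iUx.
  have iqU : cintegrable P (fun w => q * (U y w + -1 * U x w)) :=
    cintegrableZ q iUD.
  have iV : cintegrable P (fun w => -1 * V w) := cintegrableZ (-1) iF'.
  transitivity (cE (fun w => q * (U y w + -1 * U x w) + -1 * V w)).
    rewrite (cexpD iqU iV) (cexpZ q iUD) (cexpD (iF y y1) iUx).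
    rewrite (cexpZ (-1) (iF x x1)) (cexpZ (-1) iF') !mulN1r.
    by rewrite /diff_quotient mulrC.
  congr cexpectation; apply/funext => w.
  rewrite /U /V /dq /diff_quotient -/q natrM; ring.
apply: le_trans (norm_cexp_le _ iB dE) _.
  apply: cintegrable_le iB dE.
  exact: (mAf (fun a n => a%:R * dq n)).
rewrite lecR /B meanD ?meanZ //; try exact: integrable_realZ.
rewrite -/C [leRHS](splitr r) lerD //.
  have hr : h < r / 2 / c by rewrite -ltcR -hE.
  rewrite mulrAC mulrC; apply: (@le_trans _ _ (h * c)).
    by rewrite ler_wpM2l // lerDl.
  by rewrite -ler_pdivlMr // ltW.
apply: (@le_trans _ _ (2 * (r / 4))); first by rewrite ler_wpM2l.
by rewrite mulrCA ler_wpM2l ?(ltW e0) //; lra.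
Qed.
End One.
End Deriv.

Section Fact.
Lemma ffact_le_expn (n m : nat) : (n ^_ m <= n ^ m)%N.
Proof.
elim: m => [|m ih]; first by rewrite ffactn0.
by rewrite ffactnSr expnSr leq_mul // leq_subr.
Qed.

(** The summand 1 only serves [n = 0] and [j = 0], where the falling factorial
    is 1 while [0 ^ k] may vanish. *)
Lemma ffact_le_moment (n j k : nat) : (j <= k)%N -> (n ^_ j <= 1 + n ^ k)%N.
Proof.
move=> jk; apply: leq_trans (ffact_le_expn n j) _.
case: n => [|n]; last by rewrite (leq_trans (leq_pexp2l _ jk)) // leq_addl.
by case: j jk => [|j] _; [rewrite expn0 leq_addr | rewrite (exp0n (ltn0Sn j))].
Qed.
End Fact.

Section FactMoments.
Context {d : measure_display} {T : measurableType d} {R : realType}.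
Variable P : probability T R.
Local Notation integ f := (P.-integrable setT (EFin \o f)).
Local Notation cE := (cexpectation P).
Variables (N : T -> nat) (k : nat).
Hypothesis mN : all_preimages_measurable N.
Hypothesis iNk : integ (fun w => (N w)%:R ^+ k : R).

Lemma integrable_moment_le (f : nat -> nat) : (forall n, (f n <= 1 + n ^ k)%N) ->
  integ (fun w => (f (N w))%:R : R).
Proof.
move=> fk; have i1 : integ (fun=> 1 : R) by exact: finite_measure_integrable_cst.
apply: (integrable_real_le _ (integrable_realD i1 iNk)).
  exact: (apm_comp (fun n => (f n)%:R)).
by move=> w; rewrite normr_nat -natrX nat1r ler_nat; exact: fk.
Qed.

(** The weight [N ^_ j] times the exponent [N - j] is the next falling factorial,
    so differentiation shifts the index of this family. *)
Lemma derive_pgf_factor (j : nat) (x : R[i]) : (j < k)%N -> `|x| <= 1 ->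
  let F i u := cE (fun w => (N w ^_ i)%:R * u ^+ (N w - i)) in
  derivable_within (@closed_unit_disk R) (F j) x /\
  derive_within (@closed_unit_disk R) (F j) x = F j.+1 x.
Proof.
move=> jk x1 F.
have iA : integ (fun w => (N w ^_ j)%:R : R).
  by apply: (integrable_moment_le (f := fun n => n ^_ j)) => n;
    exact/ffact_le_moment/ltnW.
have iAW : integ (fun w => (N w ^_ j * (N w - j))%:R : R).
  apply: (integrable_moment_le (f := fun n => n ^_ j * (n - j))%N) => n.
  by rewrite -ffactnSr; exact: ffact_le_moment.
have := weighted_power_derive (apm_comp (fun n => n ^_ j) mN)
  (apm_comp (fun n => (n - j)%N) mN) iA iAW x1.
move=> [h1 h2]; split=> //; rewrite h2; congr cexpectation.
by apply/funext => w; rewrite ffactnSr subnS.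
Qed.

Lemma derive_within_n_pgf (j : nat) (x : R[i]) : (j <= k)%N -> `|x| <= 1 ->
  derive_within_n (@closed_unit_disk R) j (pgf P N) x =
  cE (fun w => (N w ^_ j)%:R * x ^+ (N w - j)).
Proof.
elim: j x => [|j ih] x jk x1.
  rewrite /= /pgf; congr cexpectation; apply/funext => w.
  by rewrite ffactn0 mul1r subn0.
rewrite /=; have := derive_pgf_factor jk x1.
move/(eq_derive_within_disk
  (f := derive_within_n (@closed_unit_disk R) j (pgf P N))).
by case=> // y y1; apply: ih => //; exact: ltnW.
Qed.

Lemma derivable_within_n_pgf :
  derivable_within_n (@closed_unit_disk R) k (pgf P N).
Proof.
move=> i x ik x1; have := derive_pgf_factor ik x1.
move/(eq_derive_within_disk
  (f := derive_within_n (@closed_unit_disk R) i (pgf P N))).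
by case=> // y y1; apply: derive_within_n_pgf => //; exact: ltnW.
Qed.
End FactMoments.

(** * Generating functions of sums of independent variables *)

Section RandomSum.
Context {d : measure_display} {T : measurableType d} {R : realType}.
Variable P : probability T R.
Local Notation integ f := (P.-integrable setT (EFin \o f)).
Local Notation cE := (cexpectation P).
Variables (N : {RV P >-> nat}) (X : nat -> {RV P >-> nat}).
Hypotheses (X_iid : iid X) (NX_indep : independent_of_sequence N X).

Let mN : all_preimages_measurable N.
Proof. exact/apm_nat/measurable_funPT. Qed.
Let mX i : all_preimages_measurable (X i).
Proof. exact/apm_nat/measurable_funPT. Qed.

Let p n : R := fine (P (N @^-1` [set n])).
Let q x : R := fine (P (X 0%N @^-1` [set x])).

Lemma cexp_indic (b : T -> bool) : all_preimages_measurable b ->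
  cE (fun w => (b w)%:R) = (fine (P [set w | b w]))%:C%C.
Proof.
move=> mb; rewrite -(expectation_indic _ (mb [set true])) -cexp_real.
congr cexpectation; apply/funext => w.
rewrite indicE; case: (boolP (b w)) => bw.
  by rewrite mem_set.
by rewrite memNset //=; exact/negP.
Qed.

Lemma sigma_cylinder (n : nat) (A : nat -> set nat) :
  sigma_of_sequence X (\bigcap_(i in [set` iota 0 n]) (X i @^-1` A i)).
Proof.
pose G := \bigcup_i preimage_set_system setT (X i) measurable.
rewrite bigcap_seq.
apply: (@bigsetI_measurable _ (g_sigma_algebraType G)) => i _.
apply: sub_sigma_algebra; exists i => //=.
by exists (A i) => //; rewrite setTI.
Qed.

Lemma joint_law (n : nat) (a : nat -> nat) :
  fine (P (N @^-1` [set n] `&`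
           \bigcap_(i in [set` iota 0 n]) (X i @^-1` [set a i]))) =
  p n * \prod_(i < n) q (a i).
Proof.
have [X_ind X_id] := X_iid.
rewrite NX_indep //; last exact: (sigma_cylinder n (fun i => [set a i])).
rewrite X_ind ?iota_uniq //.
have -> : (\prod_(i <- iota 0 n) P (X i @^-1` [set a i]) =
    (\prod_(i < n) q (a i))%:E)%E.
  rewrite -[n in iota 0 n]subn0 -/(index_iota 0 n) big_mkord.
  rewrite (big_morph EFin EFinM erefl); apply: eq_bigr => i _.
  by rewrite /q fineK ?fin_num_measure //; [exact: X_id | exact: mX].
rewrite -[P (N @^-1` _)]fineK ?fin_num_measure //.
Qed.

(** The law of the sequence [X] is given by events indexed by [nat], so the
    coordinates of [a] are extended by 0 to a sequence. *)
Let coord (n L : nat) (a : {ffun 'I_n -> 'I_L}) (i : nat) : nat :=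
  oapp (fun j => val (a j)) 0%N (insub i).

Let coordE (n L : nat) (a : {ffun 'I_n -> 'I_L}) (i : 'I_n) :
  coord a i = a i.
Proof. by rewrite /coord valK. Qed.

Let apm_joint (n L : nat) (a : {ffun 'I_n -> 'I_L}) : all_preimages_measurable
  (fun w => (N w == n) && [forall i : 'I_n, X i w == a i]).
Proof.
apply: (apm_op2 (fun m c => (m == n) && c)) => //.
under eq_fun => w do under eq_forallb => i do rewrite -coordE.
apply: (apm_all (b := fun i w => X i w == coord a i)) => i.
exact: (apm_comp (fun y => y == coord a i)).
Qed.

Lemma cexp_joint (n L : nat) (a : {ffun 'I_n -> 'I_L}) :
  cE (fun w => ((N w == n) && [forall i : 'I_n, X i w == a i])%:R) =
  (p n)%:C%C * \prod_(i < n) (q (a i))%:C%C.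
Proof.
rewrite cexp_indic //.
rewrite -rmorph_prod -rmorphM /=; congr (_ %:C%C).
under eq_bigr => i _ do rewrite -coordE.
rewrite -joint_law; congr (fine (P _)).
apply/seteqP; split => w /=.
  move=> /andP[/eqP nw /forallP aw]; split => // i.
  rewrite /= mem_iota add0n => /andP[_ i_n].
  by rewrite (eqP (aw (Ordinal i_n))) -coordE.
move=> [-> aw]; rewrite eqxx; apply/forallP => i.
by rewrite -coordE; apply/eqP/aw; rewrite /= mem_iota /=.
Qed.

Lemma exp_truncatedE (u : R[i]) (y L : nat) :
  u ^+ y * (y < L)%N%:R = \sum_(x < L) u ^+ x * (y == x)%:R.
Proof.
case: (ltnP y L) => yL.
  rewrite (bigD1 (Ordinal yL)) //= eqxx big1 ?addr0 // => x xy.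
  by rewrite (_ : (y == x) = false) ?mulr0 //;
    apply: contraNF xy => /eqP yx; apply/eqP/val_inj.
rewrite mulr0 big1 // => x _; rewrite (_ : (y == x) = false) ?mulr0 //.
by apply/negbTE; rewrite neq_ltn (leq_trans (ltn_ord x) yL) orbT.
Qed.

Lemma cintegrable_le1 Z : all_preimages_measurable Z ->
  (forall w, `|Z w| <= 1) -> cintegrable P Z.
Proof.
move=> mZ Z1; apply: (@cintegrable_le _ _ _ P Z (fun=> 1)) => //.
exact: finite_measure_integrable_cst.
Qed.

Lemma norm_bool_le1 (b : bool) : `|b%:R : R[i]| <= 1.
Proof. by rewrite normr_nat; case: b. Qed.

(** With all summands below [L], expanding each [u ^+ X i] over its finitely many
    values turns the left-hand side into a finite sum over outcomes, whose joint
    law is a product; distributivity folds it back into an [n]-th power. *)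
Lemma cexp_truncated_sum (n L : nat) (u : R[i]) :
  cE (fun w => ((N w == n)%:R * u ^+ (\sum_(i < n) X i w)%N)
               * [forall i : 'I_n, (X i w < L)%N]%:R) =
  (p n)%:C%C * (\sum_(x < L) u ^+ x * (q x)%:C%C) ^+ n.
Proof.
pose J (a : {ffun 'I_n -> 'I_L}) w : R[i] :=
  ((N w == n) && [forall i : 'I_n, X i w == a i])%:R.
have iJ a : cintegrable P (J a).
  apply: cintegrable_le1; last by move=> w; exact: norm_bool_le1.
  exact: (apm_comp (fun b : bool => b%:R) (apm_joint a)).
transitivity (cE (fun w => \sum_(a : {ffun 'I_n -> 'I_L})
                     (\prod_(i < n) u ^+ a i) * J a w)).
  congr cexpectation; apply/funext => w.
  have andE (b : 'I_n -> bool) :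
      [forall i, b i]%:R = \prod_(i < n) (b i)%:R :> R[i].
    case: (boolP [forall i, b i]) => [/forallP bi|].
      by rewrite big1 // => i _; rewrite bi.
    rewrite negb_forall => /existsP[i /negbTE bi].
    by rewrite (bigD1 i) //= bi mul0r.
  rewrite expr_sum -mulrA andE -big_split /=.
  under eq_bigr => i _ do rewrite exp_truncatedE.
  rewrite bigA_distr_bigA big_distrr; apply: eq_bigr => a _ /=.
  by rewrite /J -mulnb natrM andE big_split /= mulrCA.
rewrite cexp_sum; last by move=> a; exact: cintegrableZ.
under eq_bigr => a _ do rewrite (cexpZ _ (iJ a)) cexp_joint mulrCA -big_split.
rewrite -big_distrr
  -(bigA_distr_bigA (fun (i : 'I_n) (x : 'I_L) => u ^+ x * (q x)%:C%C)).
by rewrite prodr_const card_ord.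
Qed.

Lemma pgf_truncated (L : nat) (u : R[i]) :
  cE (fun w => u ^+ X 0%N w * (X 0%N w < L)%N%:R) =
  \sum_(x < L) u ^+ x * (q x)%:C%C.
Proof.
have mx (x : nat) : all_preimages_measurable (fun w => X 0%N w == x).
  exact: (apm_comp (fun y => y == x)).
have ix (x : nat) : cintegrable P (fun w => (X 0%N w == x)%:R).
  apply: cintegrable_le1; first exact: (apm_comp (fun b : bool => b%:R) (mx x)).
  by move=> w; exact: norm_bool_le1.
rewrite (funext (fun w => exp_truncatedE u (X 0%N w) L)) cexp_sum; last first.
  by move=> x; exact: cintegrableZ.
apply: eq_bigr => x _; rewrite cexpZ // cexp_indic // /q.
congr (_ * (fine (P _))%:C%C); apply/seteqP; split => w /=; first by move/eqP.
by move=> ->.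
Qed.

(** Given [N = n], the sum has the law of [n] independent copies, so its
    generating function is a power; this is the limit of the truncated identity. *)
Lemma cexp_sum_given (n : nat) (u : R[i]) : `|u| <= 1 ->
  cE (fun w => (N w == n)%:R * u ^+ (\sum_(i < n) X i w)%N) =
  (p n)%:C%C * pgf P (X 0%N) u ^+ n.
Proof.
move=> u1; have i1 : integ (fun=> 1 : R) by exact: finite_measure_integrable_cst.
have mS : all_preimages_measurable (fun w => \sum_(i < n) X i w)%N
  by exact: (apm_sum n mX).
have lt_apm (L i : nat) : all_preimages_measurable (fun w => (X i w < L)%N).
  exact: (apm_comp (fun y => (y < L)%N)).
have gt : tends_to (fun L => \sum_(x < L) u ^+ x * (q x)%:C%C)
    (pgf P (X 0%N) u).
  rewrite /pgf; under eq_fun do rewrite -pgf_truncated.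
  apply: (cexp_truncate (b := fun L w => (X 0%N w < L)%N) _ i1) => //.
  - exact: (apm_comp (fun y => u ^+ y)).
  - by move=> w; exact: norm_exp_le1.
  - by move=> w; exists (X 0%N w).+1.
apply: (tends_to_unique (s := fun L => cE (fun w =>
    ((N w == n)%:R * u ^+ (\sum_(i < n) X i w)%N) *
    [forall i : 'I_n, (X i w < L)%N]%:R))); last first.
  under eq_fun do rewrite cexp_truncated_sum.
  exact/tends_toZ/tends_toX.
apply: (cexp_truncate
  (b := fun L w => [forall i : 'I_n, (X i w < L)%N]) _ i1) => //.
- exact: (apm_op2 (fun m s => (m == n)%:R * u ^+ s)).
- move=> w; rewrite normrM mulr_ile1 // ?norm_exp_le1 //; exact: norm_bool_le1.
- by move=> L; exact: (apm_all (b := fun i w => (X i w < L)%N)).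
- move=> w; exists (\sum_(i < n) X i w).+1 => L nL; apply/forallP => i.
  by apply: leq_trans nL; rewrite ltnS (bigD1 i) //= leq_addr.
Qed.
End RandomSum.

(** * Moments of the number of summands on the values of the sum *)

Section MomentGeneratingFunction.
Context {d : measure_display} {T : measurableType d} {R : realType}.
Variable P : probability T R.
Local Notation integ f := (P.-integrable setT (EFin \o f)).
Local Notation cE := (cexpectation P).

Lemma cexp_by_value (N : T -> nat) (H : nat -> T -> R[i]) (M : nat) :
  (forall n, cintegrable P (fun w => (N w == n)%:R * H n w)) ->
  cE (fun w => H (N w) w * (N w < M)%N%:R) =
  \sum_(n < M) cE (fun w => (N w == n)%:R * H n w).
Proof.
move=> iH; rewrite -(cexp_sum _ _ (fun n : 'I_M => iH n)).
congr cexpectation; apply/funext => w.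
case: (ltnP (N w) M) => NM; last first.
  rewrite mulr0 big1 // => n _; rewrite (_ : (N w == n) = false) ?mul0r //.
  by apply/negbTE; rewrite neq_ltn (leq_trans (ltn_ord n) NM) orbT.
rewrite mulr1 (bigD1 (Ordinal NM)) //= eqxx mul1r big1 ?addr0 // => n nN.
rewrite (_ : (N w == n) = false) ?mul0r //.
by apply: contraNF nN => /eqP Nn; apply/eqP/val_inj.
Qed.

(** The term [j = 0] disappears because a nonempty set has no partition into zero
    blocks, and the terms with [n < j], where [n - j] is truncated, because the
    falling factorial vanishes. *)
Lemma expr_stirling2 (k n : nat) (g : R[i]) : (0 < k)%N ->
  (n ^ k)%:R * g ^+ n =
  \sum_(1 <= j < k.+1)
    (stirling2 k j)%:R * g ^+ j * ((n ^_ j)%:R * g ^+ (n - j)).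
Proof.
move=> k0; rewrite expn_stirling2.
rewrite -(big_mkord xpredT (fun j => stirling2 k j * n ^_ j)%N).
rewrite big_ltn // big_nat natrD natr_sum mulrDl mulr_suml.
have -> : stirling2 k 0 = 0%N.
  apply/eqP; rewrite cards_eq0; apply/eqP/setP => Q; rewrite !inE.
  apply/negbTE/negP => /andP[/and3P[/eqP Qcov _ _]].
  rewrite cards_eq0 => /eqP Q0.
  have : Ordinal k0 \in finset.cover Q by rewrite Qcov inE.
  by rewrite Q0 /finset.cover big_set0 inE.
rewrite mul0n mul0r add0r [RHS]big_nat; apply: eq_bigr => j _.
have [nj|jn] := ltnP n j.
  by rewrite ffact_small // muln0 mul0r mul0r mulr0.
by rewrite natrM mulrACA -exprD subnKC.
Qed.

Section Proof.
Variables (N : {RV P >-> nat}) (X : nat -> {RV P >-> nat}) (k : nat).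
Hypotheses (X_iid : iid X) (NX_indep : independent_of_sequence N X).
Hypothesis iNk : integ (fun w => (N w)%:R ^+ k : R).

Let mN : all_preimages_measurable N.
Proof. exact/apm_nat/measurable_funPT. Qed.
Let mX i : all_preimages_measurable (X i).
Proof. exact/apm_nat/measurable_funPT. Qed.
Let mS : all_preimages_measurable (random_sum N X).
Proof.
apply: (apm_random_index (H := fun n w => \sum_(i < n) X i w)%N) => // n.
exact: (apm_sum n mX).
Qed.

Lemma norm_pgf_le1 (Y : T -> nat) (u : R[i]) : all_preimages_measurable Y ->
  `|u| <= 1 -> `|pgf P Y u| <= 1.
Proof.
move=> mY u1.
have i1 : integ (fun=> 1 : R) by exact: finite_measure_integrable_cst.
have b w : `|u ^+ Y w| <= (1 : R)%:C%C by exact: norm_exp_le1.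
have mZ : all_preimages_measurable (fun w => u ^+ Y w).
  exact: (apm_comp (fun y => u ^+ y)).
apply: le_trans (norm_cexp_le (cintegrable_le mZ i1 b) i1 b) _.
by rewrite /mean expectation_cst.
Qed.

Let weighted (Y : T -> nat) u w : R[i] := (N w ^ k)%:R * u ^+ Y w.

Let apm_weighted Y u : all_preimages_measurable Y ->
  all_preimages_measurable (weighted Y u).
Proof. by move=> mY; exact: (apm_op2 (fun n y => (n ^ k)%:R * u ^+ y)). Qed.

Let weighted_le Y u w : `|u| <= 1 ->
  `|weighted Y u w| <= ((N w)%:R ^+ k : R)%:C%C.
Proof.
move=> u1; rewrite -natrX natr_realc normrM normr_nat ler_piMr //.
exact: norm_exp_le1.
Qed.

(** The partial sums of the series are expectations truncated to
    [random_sum N X w < L]. *)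
Lemma gf_moments (u : R[i]) : `|u| <= 1 ->
  gf_cvg (fun l => (m_ P N X k l)%:C%C) u /\
  gf (fun l => (m_ P N X k l)%:C%C) u = cE (weighted (random_sum N X) u).
Proof.
move=> u1; apply: tends_to_gf.
set S := random_sum N X.
have -> : gf_series (fun l => (m_ P N X k l)%:C%C) u =
    fun L => cE (fun w => weighted S u w * (S w < L)%N%:R).
  apply/funext => L; rewrite /gf_series seriesEord /=.
  have mW (l : nat) : all_preimages_measurable
      (fun w => (S w == l)%:R * weighted (fun=> l) u w).
    apply: (apm_op2 (fun s (z : R[i]) => (s == l)%:R * z) mS).
    exact/apm_weighted/apm_cst.
  rewrite (cexp_by_value (N := S) (H := fun l => weighted (fun=> l) u)); last first.
    move=> l; apply: (cintegrable_le (mW l) iNk) => w.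
    rewrite normrM (le_trans _ (weighted_le (fun=> l) w u1)) //.
    by rewrite ler_piMl // norm_bool_le1.
  apply: eq_bigr => l _.
  rewrite /m_ /expectation_on -/(mean P _) -cexp_real -cexpZ; last first.
    apply: cintegrable_real.
    apply: (integrable_real_le (A := fun w => (N w)%:R ^+ k)) => //.
      apply: (apm_op2 (fun n (z : R) => n%:R ^+ k * z) mN).
      rewrite (_ : \1__ = fun w => (S w == l)%:R); last first.
        apply/funext => w; rewrite indicE; congr (nat_of_bool _)%:R.
        by apply/idP/eqP; rewrite inE.
      exact: (apm_comp (fun s : nat => (s == l)%:R) mS).
    move=> w; rewrite normrM ger0_norm ?exprn_ge0 // ler_piMr ?exprn_ge0 //.
    by rewrite indicE normr_nat; case: (_ \in _).
  congr cexpectation; apply/funext => w.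
  rewrite /weighted indicE rmorphM rmorphXn /= !natr_realc natrX.
  rewrite (_ : (w \in _) = (S w == l)); last by apply/idP/eqP; rewrite inE.
  by rewrite mulrC mulrCA mulrA.
apply: (cexp_truncate (b := fun L w => (S w < L)%N) (apm_weighted _ mS) iNk).
- by move=> w; exact: weighted_le.
- by move=> L; exact: (apm_comp (fun s => (s < L)%N) mS).
- by move=> w; exists (S w).+1.
Qed.

(** Conditioning on [N]: on [N = n] the factor [N ^ k] is constant and
    [u ^+ random_sum N X] averages to the [n]-th power of the generating function
    of one summand. Both expectations are limits of their truncations to [N < M],
    where the conditioning is a finite sum. *)
Lemma cexp_weighted_random_sum (u : R[i]) : `|u| <= 1 ->
  cE (weighted (random_sum N X) u) = cE (weighted N (pgf P (X 0%N) u)).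
Proof.
move=> u1; set g := pgf P (X 0%N) u.
have g1 : `|g| <= 1 by exact: norm_pgf_le1.
have trunc (Y : T -> nat) v : all_preimages_measurable Y -> `|v| <= 1 ->
    tends_to (fun M => cE (fun w => weighted Y v w * (N w < M)%N%:R))
      (cE (weighted Y v)).
  move=> mY v1.
  apply: (cexp_truncate (b := fun M w => (N w < M)%N) (apm_weighted _ mY) iNk).
  - by move=> w; exact: weighted_le.
  - by move=> M; exact: (apm_comp (fun n => (n < M)%N) mN).
  - by move=> w; exists (N w).+1.
apply: (tends_to_unique (trunc _ _ mS u1)).
rewrite (_ : (fun M => _) = fun M => cE (fun w => weighted N g w * (N w < M)%N%:R)).
  exact: trunc.
apply/funext => M.
have slice (Y : T -> nat) v n : all_preimages_measurable Y -> `|v| <= 1 ->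
    cintegrable P (fun w => (N w == n)%:R * v ^+ Y w).
  move=> mY v1; apply: cintegrable_le1.
    exact: (apm_op2 (fun m y => (m == n)%:R * v ^+ y)).
  move=> w; rewrite normrM mulr_ile1 ?norm_exp_le1 //; exact: norm_bool_le1.
have swap (Y : T -> nat) (v : R[i]) n :
    (fun w => (N w == n)%:R * ((n ^ k)%:R * v ^+ Y w)) =
    (fun w => (n ^ k)%:R * ((N w == n)%:R * v ^+ Y w)).
  by apply/funext => w; rewrite mulrCA.
have mSn n : all_preimages_measurable (fun w => \sum_(i < n) X i w)%N.
  exact: (apm_sum n mX).
have mn (n : nat) : all_preimages_measurable (fun _ : T => n) by exact: apm_cst.
rewrite (cexp_by_value (N := N)
    (H := fun n w => (n ^ k)%:R * u ^+ (\sum_(i < n) X i w)%N)); last first.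
  by move=> n; rewrite swap; exact/cintegrableZ/(slice _ _ _ (mSn n) u1).
rewrite (cexp_by_value (N := N)
    (H := fun n w => (n ^ k)%:R * g ^+ n)); last first.
  by move=> n; rewrite (swap (fun=> n)); exact/cintegrableZ/(slice _ _ _ (mn n) g1).
apply: eq_bigr => n _; rewrite swap (swap (fun=> val n)).
rewrite (cexpZ _ (slice _ _ _ (mSn n) u1)) (cexpZ _ (slice _ _ _ (mn n) g1)).
rewrite cexp_sum_given //; congr (_ * _).
under eq_fun do rewrite mulrC.
rewrite cexpZ; last first.
  apply: cintegrable_le1; last by move=> w; exact: norm_bool_le1.
  exact: (apm_comp (fun m => (m == n :> nat)%:R) mN).
rewrite cexp_indic; last exact: (apm_comp (fun m => m == n :> nat) mN).
rewrite mulrC; congr (_ * (fine (P _))%:C%C).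
by apply/seteqP; split => w /=; [move=> -> | move/eqP].
Qed.

Lemma cexp_weighted_stirling2 (g : R[i]) : (0 < k)%N -> `|g| <= 1 ->
  cE (weighted N g) =
  \sum_(1 <= j < k.+1) (stirling2 k j)%:R * g ^+ j *
     derive_within_n (@closed_unit_disk R) j (pgf P N) g.
Proof.
move=> k0 g1; rewrite /weighted.
pose Z j w : R[i] := (N w ^_ j)%:R * g ^+ (N w - j).
have iZ j : (j <= k)%N -> cintegrable P (Z j).
  move=> jk; apply: (cintegrable_le (A := fun w => (N w ^_ j)%:R)).
  - exact: (apm_comp (fun n => (n ^_ j)%:R * g ^+ (n - j))).
  - by apply: (integrable_moment_le mN iNk (f := fun n => n ^_ j)) => n;
      exact: ffact_le_moment.
  - by move=> w; rewrite natr_realc normrM normr_nat ler_piMr // norm_exp_le1.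
rewrite (funext (fun w => expr_stirling2 (N w) g k0)).
rewrite !big_add1 !big_mkord.
under eq_fun do rewrite big_add1 big_mkord.
rewrite cexp_sum => [|j]; last exact/cintegrableZ/iZ.
apply: eq_bigr => j _; rewrite cexpZ; last exact: iZ.
by rewrite (derive_within_n_pgf mN iNk).
Qed.
End Proof.
End MomentGeneratingFunction.

Theorem proposition2p2 (d : measure_display) (T : measurableType d)
    (R : realType) (P : probability T R)
    (N : {RV P >-> nat}) (X : nat -> {RV P >-> nat}) (k : nat)
    (X_iid : iid X) (NX_indep : independent_of_sequence N X)
    (k_gt0 : (0 < k)%N)
    (ENk : ('E_P[(fun w => ((N w)%:R ^+ k)%R)] < +oo)%E) :
  derivable_within_n (@closed_unit_disk R) k (pgf P N) /\
  forall u : R[i], `|u| <= 1 ->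
    gf_cvg (fun l => (m_ P N X k l)%:C%C) u /\
    gf (fun l => (m_ P N X k l)%:C%C) u =
    \sum_(1 <= j < k.+1)
      (stirling2 k j)%:R * pgf P (X 0%N) u ^+ j *
      derive_within_n (@closed_unit_disk R) j (pgf P N) (pgf P (X 0%N) u).
Proof.
have mN : all_preimages_measurable N by exact/apm_nat/measurable_funPT.
have iNk : P.-integrable setT (EFin \o (fun w => (N w)%:R ^+ k : R)).
  apply/integrableP; split.
    apply/measurable_EFinP/apm_measurable.
    exact: (apm_comp (fun n => n%:R ^+ k)).
  apply: le_lt_trans ENk; rewrite unlock.
  by under eq_integral do rewrite /= ger0_norm ?exprn_ge0 //.
split; first exact: derivable_within_n_pgf.
move=> u u1; have [cv ->] := gf_moments X iNk u1; split=> //.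
rewrite (cexp_weighted_random_sum X_iid NX_indep iNk u1).
apply: cexp_weighted_stirling2 => //; apply: norm_pgf_le1 => //.
exact/apm_nat/measurable_funPT.
Qed.
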